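(* The randomized online algorithm $\mathrm{Rand}$ (defined in the context) is $4\ln n$-competitive for online MinLA when all revealed graphs are collections of cliques. That is, for every node set $V$ with $|V|=n$ and every clique instance $\sigma=(\pi_0;G_0,\dots,G_k)$ on $V$, $$\mathbb{E}[\mathrm{Rand}(\sigma)]\le 4\ln n\cdot \mathrm{Opt}(\sigma).$$
   Context: Let $V$ be a set of $n$ nodes. A permutation is a bijection $\pi:V\to\{1,\dots,n\}$ ($\pi(x)$ is the position of $x$; smaller positions are further left). A MinLA of a graph $G=(V,E)$ is a permutation $\pi$ minimizing $\sum_{\{x,y\}\in E}|\pi(x)-\pi(y)|$ among all permutations. $d(\pi,\pi')$ is the Kendall tau distance: the minimum number of swaps of adjacent elements transforming $\pi$ into $\pi'$. Clique instance: an arbitrary initial permutation $\pi_0$ and a sequence $G_0,\dots,G_k$ of graphs on $V$, where $G_0$ has no edges, every $G_i$ is a disjoint union of cliques (isolated nodes count as cliques of size one), and $G_{i+1}$ is obtained from $G_i$ by merging exactly two cliques into one clique. Let $X_i,Z_i$ be the node sets of the two cliques of $G_i$ that merge in $G_{i+1}$. Feasible solution: permutations $\pi_1,\dots,\pi_k$ such that $\pi_i$ is a MinLA of $G_i$ for each $i$; its cost is $\sum_{i=0}^{k-1}d(\pi_i,\pi_{i+1})$. An online algorithm must choose $\pi_i$ knowing only $\pi_0,G_0,\dots,G_i$. $\mathrm{Opt}(\sigma)$ is the minimum cost of a feasible solution of the instance $\sigma$ (full knowledge of $\sigma$). A randomized algorithm is $c$-competitive (against the oblivious adversary) if on every fixed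 instance $\sigma$ its expected cost is at most $c\cdot\mathrm{Opt}(\sigma)$. Algorithm $\mathrm{Rand}$ (cliques): when $G_{i+1}$ is revealed, starting from $\pi_i$, flip a fresh independent biased coin. With probability $|Z_i|/(|X_i|+|Z_i|)$, move the block $X_i$ (keeping its internal order) towards $Z_i$ past all nodes lying between them until $X_i$ is adjacent to $Z_i$; with the remaining probability $|X_i|/(|X_i|+|Z_i|)$, move the block $Z_i$ (keeping its internal order) towards $X_i$ until it is adjacent to $X_i$. All other relative orders are unchanged. The result is $\pi_{i+1}$. $\mathrm{Rand}(\sigma)$ is its (random) cost on $\sigma$. *)

(* Defs.v *)
From mathcomp Require Import all_boot all_order all_fingroup all_algebra.
From mathcomp Require Import reals exp.
From HB Require Import structures.

Set Implicit Arguments.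
Unset Strict Implicit.
Unset Printing Implicit Defensive.

(* A permutation of the node set, as a bijection from V to positions. Positions
   are numbered from 0 to #|V| - 1 rather than from 1 to #|V|; only their order
   and their differences are ever used. Injectivity suffices for bijectivity,
   the two finite types having the same cardinality. *)
Record arrangement (V : finType) := Arrangement {
  pos :> {ffun V -> 'I_#|V|};
  pos_injb : injectiveb pos
}.

HB.instance Definition _ (V : finType) := [isSub for @pos V].
HB.instance Definition _ (V : finType) := [Finite of arrangement V by <:].

Lemma pos_inj (V : finType) (p : arrangement V) : injective p.
Proof. exact/injectiveP/pos_injb. Qed.

Lemma arrangement_eqP (V : finType) (p q : arrangement V) : p =1 q -> p = q.
Proof. by move=> pq; apply: val_inj; apply/ffunP. Qed.

(* Used only to show that the minima below range over nonempty sets. *)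
Lemma default_arrangement_subproof (V : finType) :
  injectiveb [ffun x : V => enum_rank x].
Proof. by apply/injectiveP => x y; rewrite !ffunE; apply: enum_rank_inj. Qed.

Definition default_arrangement (V : finType) : arrangement V :=
  Arrangement (default_arrangement_subproof V).

Lemma relabel_subproof (V : finType) (p : arrangement V) (s : {perm V}) :
  injectiveb [ffun v => p (s v)].
Proof.
by apply/injectiveP => x y; rewrite !ffunE => /pos_inj; apply: perm_inj.
Qed.

Definition relabel (V : finType) (p : arrangement V) (s : {perm V}) :
  arrangement V := Arrangement (relabel_subproof p s).

Lemma relabelE (V : finType) (p : arrangement V) (s : {perm V}) v :
  relabel p s v = p (s v).
Proof. by rewrite /= ffunE. Qed.

Definition adjacent_swap (V : finType) : rel (arrangement V) := fun p q =>
  [exists x : V, exists y : V,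
    (p y == (p x).+1 :> nat) && (q == relabel p (tperm x y))].

Definition swap_path (V : finType) (p q : arrangement V) (m : nat) :
  bool :=
  [exists s : m.-tuple (arrangement V),
    path (@adjacent_swap V) p s && (last p s == q)].

Lemma connect_adjacent_tperm (V : finType) (d : nat) (p : arrangement V) x y :
  p y = p x + d.+1 :> nat ->
  connect (@adjacent_swap V) p (relabel p (tperm x y)).
Proof.
have swap1 (r : arrangement V) u v : r v = (r u).+1 :> nat ->
    connect (@adjacent_swap V) r (relabel r (tperm u v)).
  move=> e; apply/connect1/existsP; exists u; apply/existsP; exists v.
  by rewrite e !eqxx.
elim: d p x y => [|d IH] p x y pE; first by apply: swap1; rewrite pE addn1.
have pxd : p x + d.+1 < #|V|.
  by apply: ltn_trans (ltn_ord (p y)); rewrite pE ltn_add2l.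
have [|g _ gK] := @inj_card_bij _ _ p (@pos_inj _ p); first by rewrite card_ord.
pose z := g (Ordinal pxd).
have pz : p z = p x + d.+1 :> nat by rewrite /z gK.
have xz : x != z.
  by apply/eqP => e; have := pz; rewrite -e -{1}[nat_of_ord _]addn0 => /addnI.
have zy : z != y.
  by apply/eqP => e; have := pz; rewrite e pE => /addnI /eqP; rewrite eqn_leq ltnn.
have xy : x != y.
  by apply/eqP => e; have := pE; rewrite -e -{1}[nat_of_ord _]addn0 => /addnI.
have yx : y != x by rewrite eq_sym.
have zx : z != x by rewrite eq_sym.
have yz : y != z by rewrite eq_sym.
pose p1 := relabel p (tperm z y).
pose p2 := relabel p1 (tperm x y).
have c1 : connect (@adjacent_swap V) p p1 by apply: swap1; rewrite pE pz addnS.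
have c2 : connect (@adjacent_swap V) p1 p2.
  by apply: IH; rewrite !relabelE tpermR tpermD ?pz // eq_sym.
have c3 : connect (@adjacent_swap V) p2 (relabel p2 (tperm x z)).
  apply: swap1; rewrite !relabelE (@tpermD _ x y z) // !tpermL tpermR.
  by rewrite pE pz addnS.
suff -> : relabel p (tperm x y) = relabel p2 (tperm x z).
  exact: connect_trans c1 (connect_trans c2 c3).
apply: arrangement_eqP => v; rewrite !relabelE; congr (p _).
have [->|vx] := eqVneq v x; first by rewrite !tpermL (@tpermD _ x y z) // tpermL.
have [->|vy] := eqVneq v y.
  by rewrite (@tpermD _ x z y) // tpermR tpermD.
have [->|vz] := eqVneq v z.
  by rewrite tpermR tpermL tpermR tpermD.
by rewrite !tpermD // eq_sym.
Qed.

Lemma connect_adjacent_swap (V : finType) (p q : arrangement V) :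
  connect (@adjacent_swap V) p q.
Proof.
have step (r : arrangement V) x y :
    connect (@adjacent_swap V) r (relabel r (tperm x y)).
  have [e|/eqP ne] := eqVneq (r x : nat) (r y).
    have -> : relabel r (tperm x y) = r; last exact: connect0.
    move/val_inj/pos_inj: e => ->.
    by apply: arrangement_eqP => v; rewrite relabelE tperm1 perm1.
  case: (ltngtP (r x) (r y)) ne => // lt _.
    by apply: (@connect_adjacent_tperm _ (r y - (r x).+1)); rewrite addnS -addSn subnKC.
  rewrite tpermC.
  by apply: (@connect_adjacent_tperm _ (r x - (r y).+1)); rewrite addnS -addSn subnKC.
have [|g gK pgK] := @inj_card_bij _ _ p (@pos_inj _ p); first by rewrite card_ord.
have s_inj : injective (fun v => g (q v)).
  by move=> u v /(congr1 p); rewrite !pgK; apply: pos_inj.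
have -> : q = relabel p (perm s_inj).
  by apply: arrangement_eqP => v; rewrite relabelE permE pgK.
have [ts -> _] := prod_tpermP (perm s_inj).
elim/last_ind: ts p {g gK pgK s_inj} => [|ts [x y] IH] p.
  rewrite big_nil; have -> : relabel p 1%g = p; last exact: connect0.
  by apply: arrangement_eqP => v; rewrite relabelE perm1.
rewrite big_rcons /=; apply: connect_trans (step p x y) _.
have -> : relabel p (\prod_(t <- ts) tperm t.1 t.2 * tperm x y)%g =
          relabel (relabel p (tperm x y)) (\prod_(t <- ts) tperm t.1 t.2)%g.
  by apply: arrangement_eqP => v; rewrite !relabelE permM.
exact: IH.
Qed.

Lemma ex_swap_path (V : finType) (p q : arrangement V) :
  exists m, swap_path p q m.
Proof.
have /connectP[s ps qE] := connect_adjacent_swap p q.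
by exists (size s); apply/existsP; exists (in_tuple s); rewrite ps qE eqxx.
Qed.

Definition kendall_tau (V : finType) (p q : arrangement V) : nat :=
  ex_minn (ex_swap_path p q).

Record sgraph (V : finType) := SGraph {
  edge :> rel V;
  edge_sym : symmetric edge;
  edge_irr : irreflexive edge
}.

(* Each edge {x, y} is counted once, from its left endpoint. *)
Definition la_cost (V : finType) (G : sgraph V) (p : arrangement V) : nat :=
  \sum_(x : V) \sum_(y : V | G x y && (p x < p y)) (p y - p x).

Definition minla (V : finType) (G : sgraph V) (p : arrangement V) : bool :=
  [forall q : arrangement V, la_cost G p <= la_cost G q].

Lemma ex_minla (V : finType) (G : sgraph V) : exists p, minla G p.
Proof.
case: (@arg_minnP _ (default_arrangement V) xpredT (la_cost G)) => // p _ pmin.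
by exists p; apply/forallP => q; apply: pmin.
Qed.

Definition cliques_of (V : finType) (G : sgraph V) (P : {set {set V}}) : Prop :=
  partition P [set: V] /\
  (forall x y : V, G x y = (x != y) && (pblock P x == pblock P y)).

Definition merges_cliques (V : finType) (G G' : sgraph V) (X Z : {set V}) : Prop :=
  exists P : {set {set V}},
    [/\ cliques_of G P, X \in P, Z \in P, X != Z &
        cliques_of G' ((X :|: Z) |: (P :\ X :\ Z))].

(* The values of [graph] beyond [steps], and of [mergeX] and [mergeZ] from
   [steps] on, are irrelevant. *)
Record clique_instance (V : finType) := CliqueInstance {
  init : arrangement V;
  steps : nat;
  graph : nat -> sgraph V;
  mergeX : nat -> {set V};
  mergeZ : nat -> {set V};
  graph0 : forall x y : V, ~~ graph 0 x y;
  graph_cliques : forall i, i <= steps -> exists P, cliques_of (graph i) P;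
  graph_merge : forall i, i < steps ->
    merges_cliques (graph i) (graph i.+1) (mergeX i) (mergeZ i)
}.

Definition trajectory_cost (V : finType) (k : nat) (p : nat -> arrangement V) :
  nat :=
  \sum_(i < k) kendall_tau (p i) (p i.+1).

(* The tuple [s] lists the arrangements 1, ..., k; arrangement 0 is [init]. *)
Definition feasible (V : finType) (I : clique_instance V)
    (s : (steps I).-tuple (arrangement V)) : bool :=
  [forall i : 'I_(steps I), minla (graph I i.+1) (tnth s i)].

Definition solution_cost (V : finType) (I : clique_instance V)
    (s : (steps I).-tuple (arrangement V)) : nat :=
  trajectory_cost (steps I) (nth (init I) (init I :: s)).

Lemma ex_feasible_cost (V : finType) (I : clique_instance V) :
  exists c, [exists s : (steps I).-tuple (arrangement V),
    feasible s && (solution_cost s == c)].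
Proof.
pose s := [tuple xchoose (ex_minla (graph I (nat_of_ord i).+1)) | i < steps I].
exists (solution_cost s); apply/existsP; exists s; rewrite eqxx andbT.
by apply/forallP => i; rewrite tnth_mktuple; apply: xchooseP.
Qed.

Definition opt (V : finType) (I : clique_instance V) : nat :=
  ex_minn (ex_feasible_cost I).

Definition left_of (V : finType) (p : arrangement V) (X Z : {set V}) : bool :=
  [forall x in X, forall z in Z, p x < p z].

(* Is a node v outside X to the right of X, once X has been moved next to Z?
   If X comes from the left, it stops just before the first node of Z;
   otherwise it stops just after the last node of Z. *)
Definition right_of_target (V : finType) (p : arrangement V) (X Z : {set V})
    (v : V) : bool :=
  if left_of p X Z then [exists z in Z, p z <= p v]
  else [forall z in Z, p z < p v].

(* The left-to-right order after the move of X: two nodes that are both in X,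
   or both outside X, keep their relative order. *)
Definition moved_before (V : finType) (p : arrangement V) (X Z : {set V})
    (u v : V) : bool :=
  match u \in X, v \in X with
  | true, false => right_of_target p X Z v
  | false, true => ~~ right_of_target p X Z u
  | _, _ => p u < p v
  end.

Lemma right_of_target_mono (V : finType) (p : arrangement V) (X Z : {set V}) u v :
  p u < p v -> right_of_target p X Z u -> right_of_target p X Z v.
Proof.
move=> uv; rewrite /right_of_target; case: ifP => _.
  case/existsP=> z /andP[zZ zu]; apply/existsP; exists z.
  by rewrite zZ (leq_trans zu (ltnW uv)).
by move/forall_inP=> h; apply/forall_inP => z zZ; apply: ltn_trans (h z zZ) uv.
Qed.

Lemma moved_before_irr (V : finType) (p : arrangement V) (X Z : {set V}) :
  irreflexive (moved_before p X Z).
Proof. by move=> u; rewrite /moved_before; case: (u \in X); rewrite ltnn. Qed.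

Lemma moved_before_total (V : finType) (p : arrangement V) (X Z : {set V}) u v :
  u != v -> moved_before p X Z u v || moved_before p X Z v u.
Proof.
move=> uv; have : (p u : nat) != p v.
  by apply: contraNneq uv => /val_inj/pos_inj ->.
rewrite /moved_before neq_ltn.
by case: (u \in X); case: (v \in X) => //; rewrite ?orbN // orNb.
Qed.

Lemma moved_before_trans (V : finType) (p : arrangement V) (X Z : {set V}) :
  transitive (moved_before p X Z).
Proof.
have cross a b : right_of_target p X Z a -> ~~ right_of_target p X Z b ->
    p b < p a.
  move=> ha; apply: contraR; rewrite -leqNgt leq_eqVlt.
  case/orP=> [/eqP/val_inj/pos_inj <- //|ab]; exact: right_of_target_mono ab ha.
move=> v u w; rewrite /moved_before.
case: (u \in X); case: (v \in X); case: (w \in X) => //.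
- exact: ltn_trans.
- by move=> ->.
- by move=> hv vw; apply: right_of_target_mono vw hv.
- by move=> hu hw; apply: cross.
- by move=> uv; apply: contra; apply: right_of_target_mono.
- exact: ltn_trans.
Qed.

Lemma move_rank_subproof (V : finType) (p : arrangement V) (X Z : {set V}) v :
  #|[set u | moved_before p X Z u v]| < #|V|.
Proof.
apply: proper_card; apply/properP; split; first exact/subsetP.
by exists v; rewrite // inE moved_before_irr.
Qed.

Lemma move_subproof (V : finType) (p : arrangement V) (X Z : {set V}) :
  injectiveb [ffun v => Ordinal (move_rank_subproof p X Z v)].
Proof.
have lt_rank u v : moved_before p X Z u v ->
    #|[set w | moved_before p X Z w u]| < #|[set w | moved_before p X Z w v]|.
  move=> uv; apply: proper_card; apply/properP; split.
    by apply/subsetP => w; rewrite !inE => wu; apply: moved_before_trans wu uv.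
  by exists u; rewrite inE ?uv // moved_before_irr.
apply/injectiveP => u v; rewrite !ffunE => /(congr1 val) /= e.
apply/eqP; apply: contraT => uv.
by case/orP: (moved_before_total p X Z uv) => /lt_rank; rewrite e ltnn.
Qed.

(* Moves the block X towards Z until it is adjacent to Z: the new position of a
   node is the number of nodes to its left in the new order. *)
Definition move (V : finType) (p : arrangement V) (X Z : {set V}) :
  arrangement V := Arrangement (move_subproof p X Z).

(* [c] lists the outcomes of the coins; outcome [true] at step i moves the first
   of the two merging cliques. *)
Fixpoint rand_run (V : finType) (I : clique_instance V) (c : seq bool) (i : nat) :
    arrangement V :=
  if i is j.+1 then
    let p := rand_run I c j in
    if nth false c j then move p (mergeX I j) (mergeZ I j)
    else move p (mergeZ I j) (mergeX I j)
  else init I.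

Definition rand_cost (V : finType) (I : clique_instance V) (c : seq bool) : nat :=
  trajectory_cost (steps I) (rand_run I c).

Local Open Scope ring_scope.

Definition coin_prob (R : realType) (V : finType) (I : clique_instance V)
    (i : nat) (b : bool) : R :=
  (if b then #|mergeZ I i| else #|mergeX I i|)%:R /
  (#|mergeX I i| + #|mergeZ I i|)%:R.

(* The biases depend on the instance only, so that the outcomes of the
   independent coins follow a product distribution. *)
Definition expected_rand_cost (R : realType) (V : finType)
    (I : clique_instance V) : R :=
  \sum_(c : (steps I).-tuple bool)
    (\prod_(i < steps I) coin_prob R I i (tnth c i)) * (rand_cost I c)%:R.

(* Main.v *)
Require Import Defs.
From mathcomp Require Import all_boot all_order all_fingroup all_algebra.
From mathcomp Require Import reals exp zify ring lra.

(* Fix step i, merging X and Z, and let T(p) be the number of triples (x, y, z) in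
   X * ~(X u Z) * Z such that y lies between x and z in p. Either coin costs at
   most |moved block| times the number of nodes between X and Z, so that the
   expected cost of the step given the current arrangement p is at most
   2 T(p) / (|X| + |Z|). The biases make T a martingale along the earlier steps:
   its expectation is therefore T(pi_0).

   A MinLA keeps cliques contiguous. Hence, for each triple counted by T(pi_0),
   the optimal solution has inverted {x, y} or {y, z} after step i. Let D be the
   set of all pairs it ever inverts, so that |D| <= Opt. For each of its two
   endpoints u, a pair of D is charged 2 |Z| / (|X| + |Z|) at most when u is in X,
   and 2 |X| / (|X| + |Z|) when u is in Z. Since this fraction is the relative
   growth of the clique of u, its sum over the steps is at most 2 ln n. *)

Set Implicit Arguments.
Unset Strict Implicit.
Unset Printing Implicit Defensive.

(** * Kendall tau distance and inversions *)

Lemma arr_ltNge (V : finType) (p : arrangement V) (u v : V) :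
  u != v -> (p v < p u) = ~~ (p u < p v).
Proof.
move=> uv; rewrite -leqNgt [RHS]leq_eqVlt.
have [/val_inj/pos_inj vu|_ //] := eqVneq (p v : nat) (p u).
by rewrite vu eqxx in uv.
Qed.

Lemma arr_lt_neq (V : finType) (p : arrangement V) (u v : V) : p u < p v -> u != v.
Proof. by move=> uv; apply/eqP => e; rewrite e ltnn in uv. Qed.

Lemma arr_ex (V : finType) (p : arrangement V) (m : nat) :
  m < #|V| -> exists v, p v = m :> nat.
Proof.
move=> mV; have [|g _ gK] := @inj_card_bij _ _ p (@pos_inj _ p).
  by rewrite card_ord.
by exists (g (Ordinal mV)); rewrite gK.
Qed.

Lemma card_arr_lt (V : finType) (p : arrangement V) (m : nat) :
  m <= #|V| -> #|[set w | p w < m]| = m.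
Proof.
elim: m => [|m IH] mV; first by apply: eq_card0 => w; rewrite inE.
have [v pv] := @arr_ex _ p m mV.
have -> : [set w | p w < m.+1] = v |: [set w | p w < m].
  apply/setP => w; rewrite !inE ltnS leq_eqVlt; congr (_ || _).
  by rewrite -pv; apply/eqP/eqP => [/val_inj/pos_inj|->].
by rewrite cardsU1 inE pv ltnn IH // ltnW.
Qed.

Lemma arr_eq_order (V : finType) (p q : arrangement V) :
  (forall u v, p u < p v -> q u < q v) -> p = q.
Proof.
move=> pq; have pq_eq u v : (p u < p v) = (q u < q v).
  have [->|uv] := eqVneq u v; first by rewrite !ltnn.
  apply/idP/idP; first exact: pq.
  by apply: contraTT; rewrite -!arr_ltNge //; apply: pq.
apply: arrangement_eqP => v; apply: val_inj => /=.
rewrite -(@card_arr_lt _ p (p v)); last exact: ltnW.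
rewrite -(@card_arr_lt _ q (q v)); last exact: ltnW.
by apply: eq_card => w; rewrite !inE pq_eq.
Qed.

(** Each inverted pair is recorded once, oriented by [p], so the cardinality is the usual inversion
    number. *)
Definition inversions (V : finType) (p q : arrangement V) : {set V * V} :=
  [set e | (p e.1 < p e.2) && (q e.2 < q e.1)].

Lemma inversions_trans (V : finType) (p q r : arrangement V) :
  inversions p r \subset inversions p q :|: inversions q r.
Proof.
apply/subsetP => -[u v]; rewrite !inE /= => /andP[puv rvu].
by rewrite puv rvu andbT /= (arr_ltNge q) ?orNb // (@arr_lt_neq _ p).
Qed.

Lemma relabel_adjacent_lt (V : finType) (p : arrangement V) (x y u v : V) :
  p y = (p x).+1 :> nat -> (u, v) != (y, x) ->
  relabel p (tperm x y) u < relabel p (tperm x y) v -> p u < p v.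
Proof.
move=> pyx; rewrite xpair_eqE !relabelE.
have ne w t : w != t -> (p w : nat) != p t.
  by apply: contraNneq => /val_inj/pos_inj ->.
case: tpermP => [->|->|/eqP ux /eqP uy]; case: tpermP => [->|->|/eqP vx /eqP vy];
  rewrite ?eqxx ?ltnn ?pyx //=.
- by move=> _ h; exact: ltnW.
- by move=> _ h; rewrite ltn_neqAle h andbT -pyx ne // eq_sym.
- by move=> _; rewrite ltnS leq_eqVlt (negPf (ne _ _ ux)).
- by move=> _ h; apply: leq_trans h _.
Qed.

Lemma card_inversions_swap (V : finType) (p q : arrangement V) :
  adjacent_swap p q -> #|inversions p q| <= 1.
Proof.
case/existsP=> x /existsP[y /andP[/eqP pyx /eqP ->]].
rewrite -(cards1 (x, y)); apply: subset_leq_card; apply/subsetP => -[u v].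
rewrite !inE => /andP[puv]; apply: contraTT => ne.
apply/negP => /(relabel_adjacent_lt pyx) lt; move: puv => /=.
by rewrite ltnNge ltnW ?lt //; apply: contra ne => /eqP[-> ->].
Qed.

Lemma card_inversions_path (V : finType) (p q : arrangement V) (m : nat) :
  swap_path p q m -> #|inversions p q| <= m.
Proof.
case/existsP=> s /andP[ps /eqP <-]; rewrite -{2}(size_tuple s).
elim: {s m q}(val s) p ps => [|r s IH] p /=.
  move=> _; apply: eq_leq; apply: eq_card0 => -[u v]; rewrite inE /=.
  by case: ltngtP.
case/andP=> pr rs; rewrite -add1n.
apply: leq_trans (subset_leq_card (inversions_trans p r (last r s))) _.
apply: leq_trans (leq_card_setU _ _) _.
exact: leq_add (card_inversions_swap pr) (IH r rs).
Qed.

(** Induction on the gap between [u] and [v]: the right neighbour [w] of [u] in [p] is either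
    inverted with [u], or stays right of [u] in [q] and is then inverted with [v], at a smaller
    gap. *)
Lemma ex_adjacent_inversion (V : finType) (p q : arrangement V) (u v : V) :
  p u < p v -> q v < q u ->
  exists x y, p y = (p x).+1 :> nat /\ q y < q x.
Proof.
move: {2}(p v - p u) (leqnn (p v - p u)) => d.
elim: d u v => [|d IH] u v; first by rewrite leqn0 subn_eq0 leqNgt => /negbTE ->.
move=> dle puv qvu; have [e|ne] := eqVneq (p v : nat) (p u).+1; first by exists u, v.
have pu1 : (p u).+1 < p v by rewrite ltn_neqAle eq_sym ne.
have [w pw] := @arr_ex _ p (p u).+1 (ltn_trans pu1 (ltn_ord _)).
have [qwu|] := boolP (q w < q u); first by exists u, w.
rewrite -leqNgt => quw; apply: (IH w v); rewrite ?pw //; last exact: leq_trans qvu quw.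
by rewrite subnS -ltnS prednK ?subn_gt0.
Qed.

(** Bubble sort: swapping two neighbours that are inverted with respect to [q] removes this
    inversion and creates no other. *)
Lemma swap_path_le_inversions (V : finType) (p q : arrangement V) :
  exists2 m, m <= #|inversions p q| & swap_path p q m.
Proof.
move: {2}#|inversions p q| (leqnn #|inversions p q|) => d.
elim: d p => [|d IH] p dle.
  exists 0 => //; apply/existsP; exists [tuple] => /=; apply/eqP.
  apply: arr_eq_order => u v puv; apply: contraTT dle => quv.
  rewrite -ltnNge card_gt0; apply/set0Pn; exists (u, v).
  by rewrite inE /= puv arr_ltNge // (@arr_lt_neq _ p).
have [e|/set0Pn[[u v]]] := eqVneq (inversions p q) set0.
  by case: (IH p) => [|m]; rewrite ?e ?cards0 // => ? ?; exists m; rewrite ?e ?cards0.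
rewrite inE /= => /andP[puv qvu].
have [x [y [pyx qyx]]] := ex_adjacent_inversion puv qvu.
pose r := relabel p (tperm x y).
have sub : inversions r q \subset inversions p q :\ (x, y).
  apply/subsetP => -[a b]; rewrite !inE /= => /andP[rab qba].
  rewrite qba andbT; apply/andP; split.
    apply: contraTneq rab => -[-> ->].
    by rewrite !relabelE tpermL tpermR pyx ltnNge leqnSn.
  apply: (@relabel_adjacent_lt _ _ x y) rab => //; apply: contraTneq qba => -[-> ->].
  by rewrite -leqNgt ltnW.
have lt : #|inversions r q| < #|inversions p q|.
  rewrite (cardsD1 (x, y) (inversions p q)) inE /= pyx leqnn qyx /= add1n ltnS.
  exact: subset_leq_card.
have [|m mle /existsP[s /andP[rs lastq]]] := IH r.
  by rewrite -ltnS; apply: leq_trans lt dle.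
exists m.+1; first exact: leq_ltn_trans mle lt.
apply/existsP; exists [tuple of r :: s] => /=; rewrite rs lastq !andbT.
by apply/existsP; exists x; apply/existsP; exists y; rewrite pyx !eqxx.
Qed.

Lemma kendall_tauE (V : finType) (p q : arrangement V) :
  kendall_tau p q = #|inversions p q|.
Proof.
rewrite /kendall_tau; case: ex_minnP => m pm mmin; apply/eqP.
rewrite eqn_leq card_inversions_path // andbT.
have [k kle pk] := swap_path_le_inversions p q.
exact: leq_trans (mmin k pk) kle.
Qed.

(** * Merging two contiguous cliques *)

(** Read off the graph, so that no partition has to be chosen; [u == v] restores the node itself,
    edges being irreflexive. *)
Definition clique (V : finType) (G : sgraph V) (u : V) : {set V} :=
  [set v | (u == v) || G u v].

Lemma clique_pblock (V : finType) (G : sgraph V) (P : {set {set V}}) (u : V) :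
  cliques_of G P -> clique G u = pblock P u.
Proof.
move=> [/and3P[/eqP cP tP _] GE]; apply/setP => v; rewrite inE GE.
rewrite eq_pblock ?cP ?inE //.
by have [<-|//] := eqVneq u v; rewrite mem_pblock cP inE.
Qed.

Lemma mem_clique (V : finType) (G : sgraph V) (u : V) : u \in clique G u.
Proof. by rewrite inE eqxx. Qed.

Lemma clique_eq (V : finType) (G : sgraph V) (P : {set {set V}}) (u v : V) :
  cliques_of G P -> (v \in clique G u) = (clique G u == clique G v).
Proof.
move=> GP; rewrite !(clique_pblock _ GP); case: GP => /and3P[/eqP cP tP _] _.
by rewrite eq_pblock // cP inE.
Qed.

(* C and C' send a node to its clique before and after the merge of X and Z. *)
Record merging (V : finType) (C C' : V -> {set V}) (X Z : {set V}) : Prop :=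
  Merging {
    merge_mem : forall u, u \in C u;
    merge_clique : forall u v, (v \in C u) = (C u == C v);
    merge_X0 : X != set0;
    merge_Z0 : Z != set0;
    merge_XZ : [disjoint X & Z];
    merge_X : forall u, u \in X -> C u = X;
    merge_Z : forall u, u \in Z -> C u = Z;
    merge_next : forall u,
      C' u = if u \in X :|: Z then X :|: Z else C u
  }.

Lemma merging_sym (V : finType) (C C' : V -> {set V}) (X Z : {set V}) :
  merging C C' X Z -> merging C C' Z X.
Proof.
by case=> *; split=> //; [rewrite disjoint_sym | move=> u; rewrite setUC].
Qed.

Lemma card_merge (V : finType) (C C' : V -> {set V}) (X Z : {set V}) :
  merging C C' X Z -> #|X :|: Z| = #|X| + #|Z|.
Proof. by move=> M; rewrite cardsU disjoint_setI0 ?(merge_XZ M) // cards0 subn0. Qed.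

Lemma merges_merging (V : finType) (G G' : sgraph V) (X Z : {set V}) :
  merges_cliques G G' X Z -> merging (clique G) (clique G') X Z.
Proof.
case=> P [GP XP ZP XZ G'P'].
have Pp := GP.1; have /and3P[/eqP cP tP P0] := Pp.
have blockP (A : {set V}) u : A \in P -> u \in A -> clique G u = A.
  by move=> AP uA; rewrite (clique_pblock _ GP); apply: def_pblock.
split=> //.
- exact: mem_clique.
- by move=> u v; apply: clique_eq GP.
- by apply: contraNneq P0 => <-.
- by apply: contraNneq P0 => <-.
- by move/trivIsetP: tP; apply.
- by move=> u; apply: blockP.
- by move=> u; apply: blockP.
move=> u; rewrite (clique_pblock _ G'P').
have /and3P[/eqP cP' tP' _] := G'P'.1.
have [uXZ|uXZ] := boolP (u \in X :|: Z).
  by apply: def_pblock => //; rewrite !inE eqxx.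
rewrite (clique_pblock _ GP); apply: def_pblock => //.
  rewrite !inE pblock_mem ?cP ?inE // andbT; apply/orP; right.
  have uP : u \in pblock P u by rewrite mem_pblock cP inE.
  by apply/andP; split; apply: contraNneq uXZ => <-; rewrite !inE uP ?orbT.
by rewrite mem_pblock cP inE.
Qed.

(** Stated as convexity: no foreign node lies between two nodes of one clique. *)
Definition contiguous (V : finType) (C : V -> {set V}) (p : arrangement V) : Prop :=
  forall u v w, p u < p v -> p v < p w -> w \in C u -> v \in C u.

Lemma contiguous_lt (V : finType) (C : V -> {set V}) (p : arrangement V) (A : {set V}) :
  contiguous C p -> (forall u, u \in A -> C u = A) ->
  forall u v w, u \in A -> v \in A -> w \notin A -> (p u < p w) = (p v < p w).
Proof.
move=> Cp CA.
suff imp u v w : u \in A -> v \in A -> w \notin A -> p u < p w -> p v < p w.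
  by move=> u v w uA vA wA; apply/idP/idP; apply: imp.
move=> uA vA wA uw; have vw : v != w by apply: contraNneq wA => <-.
apply: contraNT wA; rewrite -arr_ltNge // => wv.
by rewrite -(CA _ uA); apply: Cp uw wv _; rewrite CA.
Qed.

Lemma contiguous_gt (V : finType) (C : V -> {set V}) (p : arrangement V) (A : {set V}) :
  contiguous C p -> (forall u, u \in A -> C u = A) ->
  forall u v w, u \in A -> v \in A -> w \notin A -> (p w < p u) = (p w < p v).
Proof.
move=> Cp CA u v w uA vA wA.
have ne x : x \in A -> x != w by move=> xA; apply: contraNneq wA => <-.
by rewrite !(@arr_ltNge _ p _ w) ?ne // (contiguous_lt Cp CA uA vA wA).
Qed.

(** Positions after the move are numbers of predecessors; these increase strictly along the
    transitive, irreflexive [moved_before], and totality gives the converse. *)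
Lemma move_lt (V : finType) (p : arrangement V) (X Z : {set V}) (u v : V) :
  (move p X Z u < move p X Z v) = moved_before p X Z u v.
Proof.
have lt_rank a b : moved_before p X Z a b -> move p X Z a < move p X Z b.
  move=> ab; rewrite !ffunE /=; apply: proper_card; apply/properP; split.
    by apply/subsetP => w; rewrite !inE => wu; apply: moved_before_trans wu ab.
  by exists a; rewrite inE ?ab // moved_before_irr.
apply/idP/idP; last exact: lt_rank.
move=> uv; have /(moved_before_total p X Z)/orP[//|/lt_rank] := arr_lt_neq uv.
by rewrite ltnNge ltnW.
Qed.

Lemma right_of_targetE (V : finType) (C C' : V -> {set V}) (X Z : {set V})
    (p : arrangement V) (z v : V) :
  merging C C' X Z -> contiguous C p -> z \in Z -> v \notin Z ->
  right_of_target p X Z v = (p z < p v).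
Proof.
move=> M Cp zZ vZ; rewrite /right_of_target.
have ltZ y : y \in Z -> (p y < p v) = (p z < p v).
  by move=> yZ; apply: (contiguous_lt Cp (merge_Z M)).
case: ifP => _.
  apply/existsP/idP => [[y /andP[yZ]]|zv]; last by exists z; rewrite zZ ltnW.
  rewrite leq_eqVlt ltZ // => /orP[/eqP/val_inj/pos_inj yv|//].
  by rewrite -yv yZ in vZ.
apply/forall_inP/idP => [|zv y yZ]; first exact.
by rewrite ltZ.
Qed.

(* Seen from outside X :|: Z, the merged clique stands after the move where Z
   stood before. *)
Lemma move_lt_target (V : finType) (C C' : V -> {set V}) (X Z : {set V})
    (p : arrangement V) (z : V) :
  merging C C' X Z -> contiguous C p -> z \in Z ->
  let t u := if u \in X :|: Z then z else u in
  forall u v, ~~ ((u \in X :|: Z) && (v \in X :|: Z)) ->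
    (move p X Z u < move p X Z v) = (p (t u) < p (t v)).
Proof.
move=> M Cp zZ t.
have outZ w : w \notin X :|: Z -> w \notin Z.
  by rewrite inE negb_or => /andP[].
have rot v := right_of_targetE M Cp zZ (v := v).
move=> u v; rewrite move_lt /moved_before /t negb_and.
have [uX|uX] := boolP (u \in X).
  rewrite [u \in X :|: Z]inE uX /= => vXZ; rewrite (negPf vXZ) -rot ?outZ //.
  by move: vXZ; rewrite inE negb_or => /andP[/negPf-> _].
have [vX|vX] := boolP (v \in X).
  rewrite [v \in X :|: Z]inE vX /= orbF => uXZ; rewrite (negPf uXZ) rot ?outZ //.
  by rewrite -arr_ltNge //; apply: contraNneq (outZ _ uXZ) => <-.
rewrite !inE (negPf uX) (negPf vX) /=.
have [uZ|uZ] := boolP (u \in Z); have [vZ|vZ] := boolP (v \in Z) => // _.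
  by apply: (contiguous_lt Cp (merge_Z M)).
by apply: (contiguous_gt Cp (merge_Z M)).
Qed.

Lemma move_contiguous (V : finType) (C C' : V -> {set V}) (X Z : {set V})
    (p : arrangement V) :
  merging C C' X Z -> contiguous C p -> contiguous C' (move p X Z).
Proof.
move=> M Cp; have /set0Pn[z zZ] := merge_Z0 M.
have tgt := move_lt_target M Cp zZ.
move=> a b c ab bc; rewrite !(merge_next M).
(* With both ends in the merged clique, an outer [b] between them would lie on both sides of [z]. *)
have [aS cS|aS] := boolP (a \in X :|: Z).
  apply: contraT => bS; move: ab bc; rewrite !tgt ?aS ?cS ?(negPf bS) //=.
  by move=> h /(ltn_trans h); rewrite ltnn.
move=> cCa; have Cac : C a = C c by apply/eqP; rewrite -(merge_clique M).
have cS : c \notin X :|: Z.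
  apply: contra aS; rewrite !inE => /orP[cX|cZ].
    by rewrite -(merge_X M cX) -Cac (merge_mem M).
  by rewrite -(merge_Z M cZ) -Cac (merge_mem M) orbT.
move: ab bc; rewrite !tgt ?(negPf aS) ?(negPf cS) ?andbF //.
(* A merged [b] is seen at [z], so [z] would lie between [a] and [c] in [p]; contiguity would then
   put [a] into [Z]. *)
have [bS|_] := boolP (b \in X :|: Z); last by move=> h k; apply: Cp h k cCa.
move=> h k; have := Cp _ _ _ h k cCa; rewrite (merge_clique M) => /eqP e.
by move: aS; rewrite inE -(merge_Z M zZ) -e (merge_mem M) orbT.
Qed.

(** The moving block only passes nodes between it and [Z]. As [z] is an arbitrary node of [Z], each
    inverted pair yields one separating triple per node of [Z]. *)
Lemma inversion_move (V : finType) (C C' : V -> {set V}) (X Z : {set V})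
    (p : arrangement V) (u v z : V) :
  merging C C' X Z -> contiguous C p -> z \in Z ->
  (u, v) \in inversions p (move p X Z) ->
  [&& u \in X, v \notin X :|: Z & (p u < p v) && (p v < p z)] ||
  [&& v \in X, u \notin X :|: Z & (p z < p u) && (p u < p v)].
Proof.
move=> M Cp zZ; rewrite !inE => /andP[]; rewrite [_.1]/= [_.2]/= => uv.
have XZ w : w \in X -> w \in Z = false.
  by move=> wX; apply: (disjointFr (merge_XZ M)).
have noloop a b : p a < p b -> p b < p a -> False.
  by move=> h /(ltn_trans h); rewrite ltnn.
have nvu : p v < p u = false by rewrite ltnNge ltnW.
rewrite move_lt /moved_before uv.
have [uX|uX] := boolP (u \in X); have [vX|vX] := boolP (v \in X);
  rewrite /= ?orbF ?nvu //.
(* A node [v] of [Z] is not passed: since [p u < p v], contiguity puts all of [X] left of all of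
   [Z], and [X] stops before [Z]. *)
- have [vZ|vZ] := boolP (v \in Z).
    rewrite /right_of_target; case: ifPn => [_ /negP[]|].
      by apply/existsP; exists v; rewrite vZ leqnn.
    case/negP; apply/forall_inP => x xX; apply/forall_inP => y yZ.
    rewrite (@contiguous_lt _ _ _ _ Cp (merge_X M) x u) ?XZ //; last first.
      by apply/negP => yX; rewrite XZ in yZ.
    by rewrite (@contiguous_gt _ _ _ _ Cp (merge_Z M) y v) ?(XZ u).
  rewrite (right_of_targetE M Cp zZ vZ) -arr_ltNge; first by move=> ->.
  by apply: contraNneq vZ => <-.
- have [uZ|uZ] := boolP (u \in Z).
    rewrite /right_of_target; case: ifPn => [lXZ|_ /forall_inP/(_ u uZ)].
      have /forall_inP/(_ u uZ) vu := forall_inP lXZ v vX.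
      by case: (noloop u v).
    by rewrite ltnn.
  by rewrite (right_of_targetE M Cp zZ uZ) => ->.
Qed.

(** * MinLAs of unions of cliques *)

Lemma card_arr_gap (V : finType) (p : arrangement V) (x y : V) : p x < p y ->
  p y - p x = (\sum_w ((p x < p w) && (p w < p y) : nat)).+1.
Proof.
move=> xy; have -> : \sum_w ((p x < p w) && (p w < p y) : nat) =
    #|[set w | p w < p y] :\: [set w | p w < (p x).+1]|.
  rewrite -sum1_card [RHS]big_mkcond; apply: eq_bigr => w _.
  by rewrite !inE -leqNgt; case: (_ && _).
rewrite cardsD (setIidPr _); last first.
  by apply/subsetP => w; rewrite !inE ltnS => /leq_ltn_trans; apply.
by rewrite !card_arr_lt ?ltn_ord ?(ltnW (ltn_ord _)) // -subSn.
Qed.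

Lemma sum_ltn_pairs (V : finType) (p : arrangement V) (S : V -> V -> nat) :
  (forall x y, S x y = S y x) ->
  2 * (\sum_x \sum_y S x y * (p x < p y)) = \sum_x \sum_y S x y * (x != y).
Proof.
move=> S_sym; rewrite mul2n -addnn {2}exchange_big -big_split /=.
apply: eq_bigr => x _; rewrite -big_split; apply: eq_bigr => y _ /=.
rewrite (S_sym y x) -mulnDr; congr (_ * _).
have [->|xy] := eqVneq x y; first by rewrite !ltnn.
by rewrite (arr_ltNge _ xy); case: (p x < p y).
Qed.

(** [S] is invariant under two transpositions generating all permutations of its arguments, so the
    six orders contribute equally, and three distinct nodes appear in exactly one of them. *)
Lemma sum_ltn_triples (V : finType) (p : arrangement V) (S : V -> V -> V -> nat) :
  (forall x y z, S x y z = S y x z) -> (forall x y z, S x y z = S x z y) ->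
  6 * (\sum_x \sum_y \sum_z S x y z * ((p x < p y) && (p y < p z))) =
  \sum_x \sum_y \sum_z S x y z * uniq [:: x; y; z].
Proof.
move=> S12 S23; pose T F := \sum_x \sum_y \sum_z S x y z * F x y z.
have T12 F : T F = T (fun x y z => F y x z).
  rewrite /T exchange_big /=; apply: eq_bigr => x _; apply: eq_bigr => y _.
  by apply: eq_bigr => z _; rewrite S12.
have T23 F : T F = T (fun x y z => F x z y).
  apply: eq_bigr => x _; rewrite exchange_big /=; apply: eq_bigr => y _.
  by apply: eq_bigr => z _; rewrite S23.
have TD F F' : T F + T F' = T (fun x y z => F x y z + F' x y z).
  rewrite -big_split; apply: eq_bigr => x _; rewrite -big_split; apply: eq_bigr => y _.
  by rewrite -big_split; apply: eq_bigr => z _; rewrite /= -mulnDr.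
pose F x y z : nat := (p x < p y) && (p y < p z).
rewrite -/(T F) -/(T (fun x y z => uniq [:: x; y; z])).
have -> : 6 * T F = T F + T (fun x y z => F y x z) + T (fun x y z => F x z y) +
    T (fun x y z => F y z x) + T (fun x y z => F z x y) + T (fun x y z => F z y x).
  have e1 := T12 F; have e2 := T23 F.
  have e3 := T12 (fun x y z => F x z y); have e4 := T23 (fun x y z => F y x z).
  have e5 := T23 (fun x y z => F y z x).
  rewrite /= in e1 e2 e3 e4 e5; lia.
rewrite !TD; apply: eq_bigr => x _; apply: eq_bigr => y _; apply: eq_bigr => z _.
congr (_ * _); rewrite /= !inE andbT negb_or /F.
have pE u v : (u == v) = (p u == p v :> nat).
  by apply/eqP/eqP => [->//|/val_inj/pos_inj].
rewrite !pE; move: (nat_of_ord _) (nat_of_ord _) (nat_of_ord _) => a b c.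
by case: (ltngtP a b); case: (ltngtP b c); case: (ltngtP a c) => /=; lia.
Qed.

(* The gap between the endpoints of an edge counts the nodes lying in between. By
   the two previous lemmas, the first two sums do not depend on p, so that only
   the third one, which counts the foreign nodes inside cliques, matters. *)
Lemma la_costE (V : finType) (G : sgraph V) (P : {set {set V}}) (p : arrangement V) :
  cliques_of G P -> la_cost G p =
  \sum_x \sum_y G x y * (p x < p y) +
  \sum_x \sum_y \sum_z ((clique G x == clique G y) && (clique G x == clique G z)) *
    ((p x < p y) && (p y < p z)) +
  \sum_x \sum_y \sum_z ((y \notin clique G x) && (z \in clique G x)) *
    ((p x < p y) && (p y < p z)).
Proof.
move=> GP; rewrite -addnA -!big_split; apply: eq_bigr => x _ /=.
rewrite -!big_split big_split /=.
(* Triples with [x] and [z] in one clique are split according to whether [y] belongs to it. *)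
have -> : \sum_y (\sum_z ((clique G x == clique G y) && (clique G x == clique G z)) *
    ((p x < p y) && (p y < p z)) +
   \sum_z ((y \notin clique G x) && (z \in clique G x)) *
    ((p x < p y) && (p y < p z))) =
  \sum_z \sum_y (z \in clique G x) * ((p x < p y) && (p y < p z)).
  rewrite [RHS]exchange_big; apply: eq_bigr => y _; rewrite -big_split /=.
  apply: eq_bigr => z _; rewrite -mulnDl -!(clique_eq _ _ GP).
  by case: (y \in _); case: (z \in _).
rewrite big_mkcond -big_split; apply: eq_bigr => y _ /=.
have GE : p x < p y -> G x y = (y \in clique G x).
  by move=> /arr_lt_neq/negPf xy; rewrite inE xy.
rewrite -big_distrr /=; have [xy|xy] := boolP (p x < p y); last first.
  rewrite andbF muln0 add0n; apply/esym/eqP; rewrite muln_eq0.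
  apply/orP; right; rewrite sum_nat_eq0; apply/forallP => w; rewrite eqb0.
  by apply: contra xy => /andP[]; apply: ltn_trans.
by rewrite andbT -GE // muln1; case: (G x y) => //; rewrite card_arr_gap // !mul1n add1n.
Qed.

(* A contiguous q has no foreign node inside a clique, hence neither has a MinLA. *)
Lemma minla_contiguous (V : finType) (G : sgraph V) (P : {set {set V}})
    (p q : arrangement V) :
  cliques_of G P -> contiguous (clique G) q -> minla G p -> contiguous (clique G) p.
Proof.
move=> GP Cq /forallP/(_ q); rewrite !(la_costE _ GP).
have G2 r := sum_ltn_pairs r (fun x y => congr1 nat_of_bool (edge_sym G x y)).
have S12 x y z :
   ((clique G x == clique G y) && (clique G x == clique G z) : nat) =
   (clique G y == clique G x) && (clique G y == clique G z).
  by rewrite (eq_sym (clique G y)); have [->|] := eqVneq (clique G x) (clique G y).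
have S23 x y z :
   ((clique G x == clique G y) && (clique G x == clique G z) : nat) =
   (clique G x == clique G z) && (clique G x == clique G y) by rewrite andbC.
have G3 r := sum_ltn_triples r S12 S23.
have G2pq := etrans (G2 p) (esym (G2 q)); have G3pq := etrans (G3 p) (esym (G3 q)).
set out := (X in _ + _ + X <= _); set outq := (X in _ <= _ + _ + X).
have outq0 : outq = 0.
  apply/eqP; rewrite sum_nat_eq0; apply/forallP => x; rewrite sum_nat_eq0.
  apply/forallP => y; rewrite sum_nat_eq0; apply/forallP => z; rewrite /= muln_eq0 !eqb0.
  rewrite -negb_and; apply/negP => /andP[/andP[/negP yx zx] /andP[xy yz]].
  by apply: yx; apply: Cq xy yz zx.
move=> le; have : out = 0 by lia.
move=> /eqP; rewrite sum_nat_eq0 => /forallP out0 u v w uv vw wu.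
have := out0 u; rewrite sum_nat_eq0 => /forallP/(_ v).
rewrite sum_nat_eq0 => /forallP/(_ w).
by rewrite /= uv vw wu andbT muln1 eqb0 negbK.
Qed.

(** * Charging to the inversions of an optimal solution *)

(** The sets are kept general because the martingale property is proved for each of the two orders
    in [separation] alone. *)
Definition chain_sum (V : finType) (A B C : {set V}) (p : arrangement V) : nat :=
  \sum_(x in A) \sum_(y in B) \sum_(z in C) ((p x < p y) && (p y < p z)).

(* |X| |Z| times the number of nodes between X and Z when X and Z are
   contiguous; at the initial arrangement, where they need not be, this counts
   the triples (x, y, z) with y outside X :|: Z and between x and z. *)
Definition separation (V : finType) (X Z : {set V}) (p : arrangement V) : nat :=
  chain_sum X (~: (X :|: Z)) Z p + chain_sum Z (~: (X :|: Z)) X p.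

Lemma separationC (V : finType) (X Z : {set V}) : separation X Z =1 separation Z X.
Proof. by move=> p; rewrite /separation addnC setUC. Qed.

Lemma separationE (V : finType) (X Z : {set V}) (p : arrangement V) :
  separation X Z p = \sum_(x in X) \sum_(y in ~: (X :|: Z)) \sum_(z in Z)
    (((p x < p y) && (p y < p z)) + ((p z < p y) && (p y < p x))).
Proof.
rewrite /separation; have -> : chain_sum Z (~: (X :|: Z)) X p =
    \sum_(x in X) \sum_(y in ~: (X :|: Z)) \sum_(z in Z) ((p z < p y) && (p y < p x)).
  rewrite /chain_sum exchange_big [RHS]exchange_big /=.
  by apply: eq_bigr => y _; rewrite exchange_big.
rewrite -big_split; apply: eq_bigr => x _ /=; rewrite -big_split.
by apply: eq_bigr => y _ /=; rewrite -big_split.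
Qed.

Lemma card_pairs (V : finType) (D : {set V * V}) :
  #|D| = \sum_u \sum_v ((u, v) \in D).
Proof.
rewrite pair_bigA -sum1_card big_mkcond /=.
by apply: eq_bigr => -[u v] _ /=; case: (_ \in _).
Qed.

(** For each fixed [z] in [Z], the inverted pairs inject into the triples with third node [z]; hence
    the factor [#|Z|]. *)
Lemma card_inversions_move (V : finType) (C C' : V -> {set V}) (X Z : {set V})
    (p : arrangement V) :
  merging C C' X Z -> contiguous C p ->
  #|Z| * #|inversions p (move p X Z)| <= separation X Z p.
Proof.
move=> M Cp; rewrite separationE (eq_bigr _ (fun x _ => exchange_big _ _ _ _ _ _)) /=.
rewrite exchange_big /= -sum_nat_const; apply: leq_sum => z zZ.
rewrite card_pairs; set S := ~: _.
under [leqRHS]eq_bigr do rewrite big_split.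
rewrite [leqRHS]big_split /= [X in _ + X]exchange_big /=.
rewrite [X in X + _]big_mkcond [X in _ + X]big_mkcond -big_split /=.
apply: leq_sum => u _.
have mk (b : bool) (A : {set V}) (F : V -> nat) :
    (if b then \sum_(v in A) F v else 0) = \sum_v (b && (v \in A)) * F v.
  case: b; last by rewrite big1.
  by rewrite big_mkcond; apply: eq_bigr => v _; case: (v \in A); rewrite ?mul1n.
rewrite !mk -big_split; apply: leq_sum => v _ /=.
case: (boolP (_ \in inversions _ _)) => // /(inversion_move M Cp zZ).
rewrite /S [u \in ~: _]inE [v \in ~: _]inE => /orP[] /and3P[-> -> ->] //=.
by rewrite addnC.
Qed.

Definition ever_inverted (V : finType) (o : nat -> arrangement V) (k : nat) :
  {set V * V} := \bigcup_(i < k) inversions (o 0) (o i.+1).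

(** A pair that joins the set at some step was not inverted just before, so that step itself inverts
    it and pays for it. *)
Lemma card_ever_inverted (V : finType) (o : nat -> arrangement V) (k : nat) :
  #|ever_inverted o k| <= trajectory_cost k o.
Proof.
rewrite /trajectory_cost /ever_inverted.
elim: k => [|k IH]; first by rewrite !big_ord0 cards0.
rewrite !big_ord_recr /= kendall_tauE.
set D := \bigcup_(i < k) _ in IH *.
have sub : D :|: inversions (o 0) (o k.+1) \subset D :|: inversions (o k) (o k.+1).
  rewrite subUset subsetUl /=.
  apply: subset_trans (inversions_trans (o 0) (o k) (o k.+1)) _.
  (* For [k = 0] the union is empty, but so is the set of inversions of [o 0] with itself. *)
  apply: setSU; rewrite /D; case: k {IH D} => [|k]; last first.
    exact: (bigcup_sup ord_max).
  by apply/subsetP => -[u v]; rewrite !inE /=; case: ltngtP.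
apply: leq_trans (subset_leq_card sub) _.
by apply: leq_trans (leq_card_setU _ _) _; rewrite leq_add2r.
Qed.

(** The degree of [u] in the graph whose edges are the pairs of [D], orientation forgotten. *)
Definition conflicts (V : finType) (D : {set V * V}) (u : V) : nat :=
  \sum_v (((u, v) \in D) || ((v, u) \in D)).

Lemma sum_conflicts (V : finType) (D : {set V * V}) :
  \sum_u conflicts D u <= 2 * #|D|.
Proof.
rewrite mul2n -addnn {1}card_pairs card_pairs [X in _ + X]exchange_big -big_split /=.
apply: leq_sum => u _; rewrite -big_split; apply: leq_sum => v _ /=.
by case: (_ \in D); case: (_ \in D).
Qed.

(** In [o] the node [y] is on one side of both [x] and [z], while in [p] it is between them, so [D]
    contains one of the two pairs. A pair at [x] in [X] is charged once per [z] in [Z], a pair at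
    [z] once per [x] in [X]. *)
Lemma separation_conflicts (V : finType) (C C' : V -> {set V}) (X Z : {set V})
    (D : {set V * V}) (p o : arrangement V) :
  merging C C' X Z -> contiguous C' o -> inversions p o \subset D ->
  separation X Z p <= \sum_u ((u \in X) * #|Z| + (u \in Z) * #|X|) * conflicts D u.
Proof.
move=> M Co /subsetP oD; pose d u v := ((u, v) \in D) || ((v, u) \in D).
have chainD x y z : x \in X -> y \notin X :|: Z -> z \in Z ->
    ((p x < p y) && (p y < p z)) + ((p z < p y) && (p y < p x)) <= d x y + d z y.
  move=> xX yXZ zZ; rewrite /d.
  have C'E u : u \in X :|: Z -> C' u = X :|: Z by move=> uXZ; rewrite (merge_next M) uXZ.
  have xXZ : x \in X :|: Z by rewrite inE xX.
  have zXZ : z \in X :|: Z by rewrite inE zZ orbT.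
  have yx : (o x < o y) = (o z < o y) by apply: (contiguous_lt Co C'E).
  have inv a b : p a < p b -> o b < o a -> (a, b) \in D.
    by move=> ab ba; apply: oD; rewrite inE /= ab.
  have xy : x != y by apply: contraNneq yXZ => <-.
  have zy : z != y by apply: contraNneq yXZ => <-.
  case: (boolP ((p x < p y) && (p y < p z))) => [/andP[pxy pyz]|_].
    rewrite (ltnNge (p z)) (ltnW pyz) /= addn0.
    have [oxy|] := boolP (o x < o y); first by rewrite (inv y z) -?yx // orbT addn1.
    by rewrite -arr_ltNge // => oyx; rewrite (inv x y).
  rewrite add0n; case: (boolP (_ && _)) => [/andP[pzy pyx]|//].
  have [oxy|] := boolP (o x < o y); first by rewrite (inv y x) // orbT.
  by rewrite yx -arr_ltNge // => oyz; rewrite (inv z y) // addn1.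
rewrite separationE.
apply: leq_trans (_ : \sum_(x in X) \sum_(y in ~: (X :|: Z)) \sum_(z in Z)
   (d x y + d z y) <= _).
  apply: leq_sum => x xX; apply: leq_sum => y; rewrite inE => yXZ.
  by apply: leq_sum => z zZ; apply: chainD.
(* Letting [y] range over all nodes only enlarges the sum and makes full degrees appear. *)
apply: leq_trans (_ : \sum_(x in X) \sum_y \sum_(z in Z) (d x y + d z y) <= _).
  apply: leq_sum => x _; rewrite [leqRHS](bigID (fun y => y \in ~: (X :|: Z))).
  exact: leq_addr.
have -> : \sum_(x in X) \sum_y \sum_(z in Z) (d x y + d z y) =
   \sum_(x in X) \sum_y \sum_(z in Z) d x y + \sum_(x in X) \sum_y \sum_(z in Z) d z y.
  rewrite -big_split; apply: eq_bigr => x _; rewrite -big_split; apply: eq_bigr => y _.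
  by rewrite -big_split.
have -> : \sum_(x in X) \sum_y \sum_(z in Z) d x y =
    \sum_u (u \in X) * #|Z| * conflicts D u.
  rewrite big_mkcond; apply: eq_bigr => u _; case: (u \in X) => //.
  rewrite mul1n [RHS]big_distrr; apply: eq_bigr => y _ /=.
  by rewrite sum_nat_const.
have -> : \sum_(x in X) \sum_y \sum_(z in Z) d z y =
    \sum_u (u \in Z) * #|X| * conflicts D u.
  rewrite sum_nat_const exchange_big big_mkcond [LHS]big_distrr; apply: eq_bigr => u _ /=.
  by case: (u \in Z); rewrite ?muln0 // mul1n.
by rewrite -big_split; under [leqRHS]eq_bigr do rewrite mulnDl.
Qed.

Lemma instance_merging (V : finType) (I : clique_instance V) (i : nat) :
  i < steps I ->
  merging (clique (graph I i)) (clique (graph I i.+1)) (mergeX I i) (mergeZ I i).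
Proof. by move=> /graph_merge/merges_merging. Qed.

Lemma rand_run_contiguous (V : finType) (I : clique_instance V) (c : seq bool) (i : nat) :
  i <= steps I -> contiguous (clique (graph I i)) (rand_run I c i).
Proof.
elim: i => [_|i IH iI] /=.
  move=> u v w uv vw; rewrite inE (negPf (graph0 I u w)) orbF => /eqP uw.
  by rewrite uw in uv; have := ltn_trans uv vw; rewrite ltnn.
have M := instance_merging iI.
case: ifP => _; first exact: move_contiguous M (IH (ltnW iI)).
exact: move_contiguous (merging_sym M) (IH (ltnW iI)).
Qed.

(** One set [D] serves all steps, which is what allows the charges to be summed over time. *)
Lemma separation_opt (V : finType) (I : clique_instance V) :
  exists D : {set V * V}, #|D| <= opt I /\ forall i, i < steps I ->
    separation (mergeX I i) (mergeZ I i) (init I) <=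
    \sum_u ((u \in mergeX I i) * #|mergeZ I i| + (u \in mergeZ I i) * #|mergeX I i|) *
      conflicts D u.
Proof.
rewrite /opt; case: ex_minnP => m /existsP[s /andP[/forallP feas /eqP <-]] _.
pose o := nth (init I) (init I :: s); exists (ever_inverted o (steps I)).
split; first exact: card_ever_inverted.
move=> i iI; have M := instance_merging iI.
have [P GP] := graph_cliques iI.
(* Any run of the algorithm witnesses that contiguous arrangements exist. *)
have Cr := @rand_run_contiguous _ I [::] _ iI.
have /(minla_contiguous GP Cr) Co : minla (graph I i.+1) (o i.+1).
  by have := feas (Ordinal iI); rewrite (tnth_nth (init I)).
by apply: (separation_conflicts M Co); apply: (bigcup_sup (Ordinal iI)).
Qed.

(** * Expectations over the coins *)

Import Order.TTheory GRing.Theory Num.Theory.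
Local Open Scope ring_scope.

Definition expect (R : realType) (V : finType) (I : clique_instance V) (m : nat)
    (F : seq bool -> R) : R :=
  \sum_(c : m.-tuple bool) (\prod_(i < m) coin_prob R I i (tnth c i)) * F c.

(** The conditional expectation of [F] at the next arrangement, given the current one [p]. *)
Definition average_step (R : realType) (V : finType) (I : clique_instance V) (i : nat)
    (F : arrangement V -> R) (p : arrangement V) : R :=
  coin_prob R I i true * F (move p (mergeX I i) (mergeZ I i)) +
  coin_prob R I i false * F (move p (mergeZ I i) (mergeX I i)).

Lemma coin_prob_ge0 (R : realType) (V : finType) (I : clique_instance V) i b :
  0 <= coin_prob R I i b.
Proof. by rewrite /coin_prob divr_ge0 ?ler0n. Qed.

Lemma merge_size_gt0 (R : realType) (V : finType) (C C' : V -> {set V}) (X Z : {set V}) :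
  merging C C' X Z -> 0 < (#|X| + #|Z|)%:R :> R.
Proof. by move=> M; rewrite ltr0n addn_gt0 card_gt0 (merge_X0 M). Qed.

Lemma expectS (R : realType) (V : finType) (I : clique_instance V) m
    (F : seq bool -> R) :
  expect I m.+1 F = expect I m (fun c =>
    coin_prob R I m true * F (rcons c true) + coin_prob R I m false * F (rcons c false)).
Proof.
pose h (cb : m.-tuple bool * bool) := [tuple of rcons cb.1 cb.2].
have h_bij : bijective h.
  apply: inj_card_bij => [[c b] [c' b'] /(congr1 val) /rcons_inj[/val_inj-> ->] //|].
  by rewrite card_prod !card_tuple card_bool expnSr.
rewrite /expect (reindex h) /=; last exact: onW_bij.
rewrite -(pair_bigA _ (fun c b => (\prod_(i < m.+1) coin_prob R I i (tnth (h (c, b)) i)) *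
   F (rcons c b))) /=.
apply: eq_bigr => c _.
have hE b : \prod_(i < m.+1) coin_prob R I i (tnth (h (c, b)) i) =
    (\prod_(i < m) coin_prob R I i (tnth c i)) * coin_prob R I m b.
  rewrite big_ord_recr /=; congr (_ * _).
    apply: eq_bigr => i _; rewrite (tnth_nth b) /= nth_rcons size_tuple ltn_ord.
    by rewrite -tnth_nth.
  by rewrite (tnth_nth b) /= nth_rcons size_tuple ltnn eqxx.
by rewrite big_bool /= !hE mulrDr !mulrA.
Qed.

Lemma eq_expect (R : realType) (V : finType) (I : clique_instance V) m
    (F G : seq bool -> R) :
  (forall c, size c = m -> F c = G c) -> expect I m F = expect I m G.
Proof. by move=> FG; apply: eq_bigr => c _; rewrite FG ?size_tuple. Qed.

Lemma expectD (R : realType) (V : finType) (I : clique_instance V) m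
    (F G : seq bool -> R) :
  expect I m (fun c => F c + G c) = expect I m F + expect I m G.
Proof. by rewrite -big_split; apply: eq_bigr => c _; rewrite mulrDr. Qed.

Lemma expectZ (R : realType) (V : finType) (I : clique_instance V) m
    (a : R) (F : seq bool -> R) :
  expect I m (fun c => a * F c) = a * expect I m F.
Proof. by rewrite /expect mulr_sumr; apply: eq_bigr => c _; rewrite mulrCA. Qed.

Lemma ler_expect (R : realType) (V : finType) (I : clique_instance V) m
    (F G : seq bool -> R) :
  (forall c, F c <= G c) -> expect I m F <= expect I m G.
Proof.
move=> FG; apply: ler_sum => c _; apply: ler_wpM2l (FG _).
by apply: prodr_ge0 => i _; apply: coin_prob_ge0.
Qed.

Lemma rand_run_rcons (V : finType) (I : clique_instance V) (c : seq bool) b i :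
  (i <= size c)%N -> rand_run I (rcons c b) i = rand_run I c i.
Proof.
elim: i => //= i IH ic; rewrite IH 1?ltnW // nth_rcons.
by rewrite ic.
Qed.

Lemma expect_rand_runS (R : realType) (V : finType) (I : clique_instance V) m
    (F : arrangement V -> R) :
  expect I m.+1 (fun c => F (rand_run I c m.+1)) =
  expect I m (fun c => average_step I m F (rand_run I c m)).
Proof.
rewrite expectS; apply: eq_expect => c cm.
by rewrite /average_step /= !rand_run_rcons ?cm // !nth_rcons cm ltnn eqxx.
Qed.

Lemma coin_prob_sum (R : realType) (V : finType) (I : clique_instance V) i :
  (i < steps I)%N -> coin_prob R I i true + coin_prob R I i false = 1.
Proof.
move=> iI; rewrite /coin_prob -mulrDl -natrD addnC divff // gt_eqF //.
exact: merge_size_gt0 (instance_merging iI).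
Qed.

(** The cost of step [i] depends on the coins up to [i] only: coin [i] is averaged in
    [average_step], and the later ones integrate to 1. *)
Lemma expect_trajectory_cost (R : realType) (V : finType) (I : clique_instance V) m :
  (m <= steps I)%N ->
  expect I m (fun c => (trajectory_cost m (rand_run I c))%:R) =
  \sum_(i < m) expect I i (fun c =>
    average_step I i (fun q => (kendall_tau (rand_run I c i) q)%:R) (rand_run I c i)) :> R.
Proof.
elim: m => [|m IH] mI.
  rewrite big_ord0 /expect big1 // => c _; rewrite /trajectory_cost big_ord0.
  by rewrite big_ord0 mulr0.
rewrite big_ord_recr /=.
rewrite -(IH (ltnW mI)).
rewrite -expectD.
rewrite expectS.
apply: eq_expect => c cm.
have costE b : trajectory_cost m.+1 (rand_run I (rcons c b)) =
    (trajectory_cost m (rand_run I c) +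
     kendall_tau (rand_run I c m) (rand_run I (rcons c b) m.+1))%N.
  rewrite /trajectory_cost big_ord_recr rand_run_rcons ?cm //; congr (_ + _)%N.
  by apply: eq_bigr => i _; rewrite !rand_run_rcons ?cm /= ?(ltnW (ltn_ord i)).
rewrite !costE /average_step /= !rand_run_rcons ?cm // !nth_rcons cm ltnn eqxx.
have := coin_prob_sum R mI; rewrite !natrD.
move: (coin_prob _ _ _ true) (coin_prob _ _ _ false) => a b ab.
by rewrite (_ : b = 1 - a); [ring | rewrite -ab; ring].
Qed.

(** The [#|X| + #|Z|] merged nodes all get the value [g z] or all get [g x]; with the biases of the
    coin their expected total is [#|Z| * g z + #|X| * g x], which is the original one. *)
Lemma average_sum (R : realType) (V : finType) (C C' : V -> {set V})
    (X Z A : {set V}) (x z : V) (g : V -> R) :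
  merging C C' X Z -> x \in X -> z \in Z ->
  (forall u, u \in X -> g u = g x) -> (forall u, u \in Z -> g u = g z) ->
  (X :|: Z \subset A) || [disjoint X :|: Z & A] ->
  #|Z|%:R / (#|X| + #|Z|)%:R * (\sum_(u in A) g (if u \in X :|: Z then z else u)) +
  #|X|%:R / (#|X| + #|Z|)%:R * (\sum_(u in A) g (if u \in X :|: Z then x else u)) =
  \sum_(u in A) g u.
Proof.
move=> M xX zZ gX gZ SA; have s0 := merge_size_gt0 R M.
have sumX v : \sum_(u in X :|: Z) g v = (#|X| + #|Z|)%:R * g v.
  by rewrite sumr_const (card_merge M) mulr_natl.
have outside (y : V) (T : {set V}) : [disjoint X :|: Z & T] ->
    \sum_(u in T) g (if u \in X :|: Z then y else u) = \sum_(u in T) g u.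
  by move=> ST; apply: eq_bigr => u uT; rewrite (disjointFl ST).
case/orP: SA => [SA|SA]; last first.
  rewrite !outside // -mulrDl -mulrDl -natrD addnC divff ?mul1r //.
  by rewrite gt_eqF.
have split (h : V -> R) : \sum_(u in A) h u =
    \sum_(u in X :|: Z) h u + \sum_(u in A :\: (X :|: Z)) h u.
  by rewrite (big_setID (X :|: Z)) /= (setIidPr SA).
have inside (y : V) : \sum_(u in X :|: Z) g (if u \in X :|: Z then y else u) =
    (#|X| + #|Z|)%:R * g y.
  by rewrite -sumX; apply: eq_bigr => u ->.
have dis : [disjoint X :|: Z & A :\: (X :|: Z)].
  by rewrite disjoint_sym disjoints_subset setDE subsetIr.
rewrite !split !inside !(outside _ _ dis).
have -> : \sum_(u in X :|: Z) g u = #|X|%:R * g x + #|Z|%:R * g z.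
  rewrite (eq_bigl [predU X & Z]) => [|u]; last by rewrite !inE.
  rewrite bigU ?(merge_XZ M) //=.
  rewrite (eq_bigr (fun=> g x)) // [X in _ + X](eq_bigr (fun=> g z)) //.
  by rewrite !sumr_const !mulr_natl.
move: s0; rewrite natrD; set r := \sum_(u in A :\: (X :|: Z)) g u => s0.
by field; rewrite gt_eqF.
Qed.

(* At most one of A, B, D meets X :|: Z, and it then contains X :|: Z: its |X| +
   |Z| merged nodes are all seen where Z was with probability |Z| / (|X| + |Z|),
   where X was otherwise, so that the expected sum is unchanged. *)
Lemma average_chain_sum (R : realType) (V : finType) (C C' : V -> {set V})
    (X Z A B D : {set V}) (p : arrangement V) :
  merging C C' X Z -> contiguous C p ->
  [disjoint A & B] -> [disjoint B & D] -> [disjoint A & D] ->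
  (forall u, u \in A -> C' u \subset A) -> (forall u, u \in B -> C' u \subset B) ->
  (forall u, u \in D -> C' u \subset D) ->
  #|Z|%:R / (#|X| + #|Z|)%:R * (chain_sum A B D (move p X Z))%:R +
  #|X|%:R / (#|X| + #|Z|)%:R * (chain_sum A B D (move p Z X))%:R =
  (chain_sum A B D p)%:R :> R.
Proof.
move=> M Cp AB BD AD sA sB sD; set S := X :|: Z.
have /set0Pn[x xX] := merge_X0 M; have /set0Pn[z zZ] := merge_Z0 M.
have sat (T : {set V}) : (forall u, u \in T -> C' u \subset T) ->
    (S \subset T) || [disjoint S & T].
  move=> sT; case: (boolP [disjoint S & T]) => //; rewrite ?orbT //.
  case/pred0Pn => u /= /andP[uS /sT]; rewrite (merge_next M) -/S.
  by rewrite [_ \in _]uS orbF.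
have excl (T U : {set V}) : [disjoint T & U] -> S \subset T -> [disjoint S & U].
  by move=> TU ST; apply: disjointWl TU.
have tz := move_lt_target M Cp zZ.
have tx := move_lt_target (merging_sym M) Cp xX; rewrite (setUC Z) in tx.
pose lt u v : R := (p u < p v)%N%:R.
have natE q : (chain_sum A B D q)%:R =
    \sum_(a in A) \sum_(b in B) \sum_(d in D) (q a < q b)%N%:R * (q b < q d)%N%:R :> R.
  rewrite natr_sum; apply: eq_bigr => a _; rewrite natr_sum; apply: eq_bigr => b _.
  by rewrite natr_sum; apply: eq_bigr => d _; rewrite -natrM mulnb.
have ltC u v w : w \notin S -> u \in X -> v \in X ->
   (lt u w = lt v w) * (lt w u = lt w v).
  rewrite inE negb_or => /andP[wX _] uX vX; rewrite /lt.
  by rewrite (contiguous_lt Cp (merge_X M) uX vX) // (contiguous_gt Cp (merge_X M) uX vX).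
have ltCZ u v w : w \notin S -> u \in Z -> v \in Z ->
   (lt u w = lt v w) * (lt w u = lt w v).
  rewrite inE negb_or => /andP[_ wZ] uX vX; rewrite /lt.
  by rewrite (contiguous_lt Cp (merge_Z M) uX vX) // (contiguous_gt Cp (merge_Z M) uX vX).
(* [q] orders the nodes as [p] does once the merged clique is collapsed to [y]. *)
pose follows (q : arrangement V) y := forall u v, ~~ ((u \in S) && (v \in S)) ->
    (q u < q v)%N = (p (if u \in S then y else u) < p (if v \in S then y else v))%N.
have fz : follows (move p X Z) z by [].
have fx : follows (move p Z X) x by [].
have notin (T : {set V}) u : [disjoint S & T] -> u \in T -> u \in S = false.
  by move=> ST uT; rewrite (disjointFl ST).
rewrite !natE.
(* Case analysis on which set contains [S]. In each case the sum is written as a sum of [g] over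
   that set, the other two indices being outside [S]. The last case also covers [S] disjoint from
   all three. *)
have [SB|SB] := boolP [disjoint S & B]; last first.
  have SB' : S \subset B by case/orP: (sat B sB) => // SB'; rewrite SB' in SB.
  have SA : [disjoint S & A] by apply: excl SB'; rewrite disjoint_sym.
  have SD : [disjoint S & D] by apply: excl SB'.
  pose g b := \sum_(a in A) \sum_(d in D) lt a b * lt b d.
  have E q y : follows q y ->
      \sum_(a in A) \sum_(b in B) \sum_(d in D) (q a < q b)%N%:R * (q b < q d)%N%:R =
      \sum_(b in B) g (if b \in S then y else b).
    move=> qy; rewrite exchange_big /=; apply: eq_bigr => b _; apply: eq_bigr => a aA.
    apply: eq_bigr => d dD.
    by rewrite !qy ?(notin _ _ SA aA) ?(notin _ _ SD dD) ?andbF.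
  rewrite (E _ _ fz) (E _ _ fx) (average_sum M xX zZ) ?sat //.
  - by rewrite exchange_big.
  - move=> u uX; apply: eq_bigr => a aA; apply: eq_bigr => d dD.
    by rewrite !(ltC u x) // ?(notin _ _ SA aA) ?(notin _ _ SD dD).
  - move=> u uX; apply: eq_bigr => a aA; apply: eq_bigr => d dD.
    by rewrite !(ltCZ u z) // ?(notin _ _ SA aA) ?(notin _ _ SD dD).
have [SA|SA] := boolP [disjoint S & A]; last first.
  have SA' : S \subset A by case/orP: (sat A sA) => // SA'; rewrite SA' in SA.
  have SD : [disjoint S & D] by apply: excl SA'.
  pose g a := \sum_(b in B) \sum_(d in D) lt a b * lt b d.
  have E q y : follows q y ->
      \sum_(a in A) \sum_(b in B) \sum_(d in D) (q a < q b)%N%:R * (q b < q d)%N%:R =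
      \sum_(a in A) g (if a \in S then y else a).
    move=> qy; apply: eq_bigr => a _; apply: eq_bigr => b bB; apply: eq_bigr => d dD.
    by rewrite !qy ?(notin _ _ SB bB) ?(notin _ _ SD dD) ?andbF.
  rewrite (E _ _ fz) (E _ _ fx) (average_sum M xX zZ) ?sat //.
  - move=> u uX; apply: eq_bigr => b bB; apply: eq_bigr => d dD.
    by rewrite !(ltC u x) // ?(notin _ _ SB bB) ?(notin _ _ SD dD).
  - move=> u uX; apply: eq_bigr => b bB; apply: eq_bigr => d dD.
    by rewrite !(ltCZ u z) // ?(notin _ _ SB bB) ?(notin _ _ SD dD).
pose g d := \sum_(a in A) \sum_(b in B) lt a b * lt b d.
have exch (F : V -> V -> V -> R) : \sum_(a in A) \sum_(b in B) \sum_(d in D) F a b d =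
    \sum_(d in D) \sum_(a in A) \sum_(b in B) F a b d.
  by rewrite [RHS]exchange_big; apply: eq_bigr => a _; rewrite exchange_big.
have E q y : follows q y ->
    \sum_(a in A) \sum_(b in B) \sum_(d in D) (q a < q b)%N%:R * (q b < q d)%N%:R =
    \sum_(d in D) g (if d \in S then y else d).
  move=> qy; rewrite exch; apply: eq_bigr => d _; apply: eq_bigr => a aA.
  apply: eq_bigr => b bB.
  by rewrite !qy ?(notin _ _ SB bB) ?(notin _ _ SA aA) ?andbF.
rewrite (E _ _ fz) (E _ _ fx) (average_sum M xX zZ) ?sat //.
- move=> u uX; apply: eq_bigr => a aA; apply: eq_bigr => b bB.
  by rewrite !(ltC u x) // ?(notin _ _ SB bB) ?(notin _ _ SA aA).
- move=> u uX; apply: eq_bigr => a aA; apply: eq_bigr => b bB.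
  by rewrite !(ltCZ u z) // ?(notin _ _ SB bB) ?(notin _ _ SA aA).
Qed.

Lemma clique_graph0 (V : finType) (I : clique_instance V) (u : V) :
  clique (graph I 0) u = [set u].
Proof. by apply/setP => v; rewrite !inE (negPf (graph0 I u v)) orbF eq_sym. Qed.

Lemma clique_mono (V : finType) (I : clique_instance V) (j i : nat) (u : V) :
  (j <= i)%N -> (i <= steps I)%N ->
  clique (graph I j) u \subset clique (graph I i) u.
Proof.
elim: i => [|i IH]; first by rewrite leqn0 => /eqP->.
rewrite leq_eqVlt => /orP[/eqP->//|ji] iI; have M := instance_merging iI.
apply: subset_trans (IH ji (ltnW iI)) _; rewrite (merge_next M).
case: ifP => // /setUP[uX|uZ]; first by rewrite (merge_X M uX) subsetUl.
by rewrite (merge_Z M uZ) subsetUr.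
Qed.

(** Cliques only grow, so sets closed under the cliques of step [i] are closed under all earlier
    ones, and every earlier step preserves the expectation. *)
Lemma expect_chain_sum (R : realType) (V : finType) (I : clique_instance V)
    (A B D : {set V}) (i : nat) :
  (i <= steps I)%N ->
  [disjoint A & B] -> [disjoint B & D] -> [disjoint A & D] ->
  (forall u, u \in A -> clique (graph I i) u \subset A) ->
  (forall u, u \in B -> clique (graph I i) u \subset B) ->
  (forall u, u \in D -> clique (graph I i) u \subset D) ->
  expect I i (fun c => (chain_sum A B D (rand_run I c i))%:R) =
  (chain_sum A B D (init I))%:R :> R.
Proof.
move=> iI AB BD AD sA sB sD.
suff E j : (j <= i)%N -> expect I j (fun c => (chain_sum A B D (rand_run I c j))%:R) =
    (chain_sum A B D (init I))%:R :> R by apply: E.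
elim: j => [_|j IH ji].
  rewrite /expect (big_pred1 [tuple]); first by rewrite big_ord0 mul1r.
  by move=> c; apply/esym/eqP; apply: tuple0.
have jI := leq_trans ji iI.
rewrite (expect_rand_runS _ _ (fun p => (chain_sum A B D p)%:R)) -(IH (ltnW ji)).
apply: eq_expect => c _; rewrite /average_step /coin_prob.
apply: average_chain_sum (instance_merging jI) _ AB BD AD _ _ _.
- exact: rand_run_contiguous (ltnW jI).
- by move=> u uA; apply: subset_trans (clique_mono u ji iI) (sA u uA).
- by move=> u uB; apply: subset_trans (clique_mono u ji iI) (sB u uB).
- by move=> u uD; apply: subset_trans (clique_mono u ji iI) (sD u uD).
Qed.

Lemma expect_separation (R : realType) (V : finType) (I : clique_instance V) (i : nat) :
  (i < steps I)%N ->
  expect I i (fun c => (separation (mergeX I i) (mergeZ I i) (rand_run I c i))%:R) =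
  (separation (mergeX I i) (mergeZ I i) (init I))%:R :> R.
Proof.
move=> iI; have M := instance_merging iI.
have sX u : u \in mergeX I i -> clique (graph I i) u \subset mergeX I i.
  by move=> uX; rewrite (merge_X M uX).
have sZ u : u \in mergeZ I i -> clique (graph I i) u \subset mergeZ I i.
  by move=> uZ; rewrite (merge_Z M uZ).
(* The complement is closed too: a clique meeting [X] or [Z] is equal to it. *)
have sS u : u \in ~: (mergeX I i :|: mergeZ I i) ->
    clique (graph I i) u \subset ~: (mergeX I i :|: mergeZ I i).
  rewrite inE => uS; apply/subsetP => v.
  rewrite (merge_clique M) inE => /eqP uv; apply: contra uS.
  have := merge_mem M u; rewrite uv => + /setUP[vX|vZ]; rewrite [u \in _ :|: _]inE.
    by rewrite (merge_X M vX) => ->.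
  by rewrite (merge_Z M vZ) => ->; rewrite orbT.
have dX : [disjoint mergeX I i & ~: (mergeX I i :|: mergeZ I i)].
  by rewrite disjoints_subset setCK subsetUl.
have dZ : [disjoint mergeZ I i & ~: (mergeX I i :|: mergeZ I i)].
  by rewrite disjoints_subset setCK subsetUr.
have XZ := merge_XZ M.
rewrite /separation natrD -(expect_chain_sum R (ltnW iI) dX _ XZ) //; last first.
  by rewrite disjoint_sym.
rewrite -(expect_chain_sum R (ltnW iI) dZ) //; try by rewrite disjoint_sym.
by rewrite -expectD; apply: eq_expect => c _; rewrite natrD.
Qed.

(** Moving [X] has probability proportional to [#|Z|], exactly the factor in [card_inversions_move].
    Each outcome thus contributes at most the separation over [#|X| + #|Z|]; the 2 counts the
    outcomes. *)
Lemma average_step_cost (R : realType) (V : finType) (I : clique_instance V) (i : nat)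
    (p : arrangement V) :
  (i < steps I)%N -> contiguous (clique (graph I i)) p ->
  average_step I i (fun q => (kendall_tau p q)%:R) p <=
  2 / (#|mergeX I i| + #|mergeZ I i|)%:R *
  (separation (mergeX I i) (mergeZ I i) p)%:R :> R.
Proof.
move=> iI Cp; have M := instance_merging iI.
rewrite /average_step /coin_prob !kendall_tauE.
have := card_inversions_move M Cp; have := card_inversions_move (merging_sym M) Cp.
rewrite separationC -!(ler_nat R) !natrM.
have : 0 <= ((#|mergeX I i| + #|mergeZ I i|)%:R : R)^-1 by rewrite invr_ge0.
move: (_^-1) => r r0 h1 h2.
rewrite (_ : 2 * r * _ = r * ((separation (mergeX I i) (mergeZ I i) p)%:R +
   (separation (mergeX I i) (mergeZ I i) p)%:R)); last by ring.
rewrite mulrAC [X in _ + X]mulrAC -mulrDl mulrC.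
by apply: ler_wpM2l => //; apply: lerD.
Qed.

(** The sum telescopes: growth of the clique of [u] from [x] to [x + z] nodes adds at most
    [ln (x + z) - ln x], starting from a singleton. *)
Lemma sum_growth_le_ln (R : realType) (V : finType) (I : clique_instance V) (u : V) m :
  (m <= steps I)%N ->
  \sum_(i < m)
    ((u \in mergeX I i) * #|mergeZ I i| + (u \in mergeZ I i) * #|mergeX I i|)%:R /
    (#|mergeX I i| + #|mergeZ I i|)%:R <= ln (#|clique (graph I m) u|%:R) :> R.
Proof.
elim: m => [_|m IH mI]; first by rewrite big_ord0 clique_graph0 cards1 ln1.
rewrite big_ord_recr /=; have M := instance_merging mI.
apply: le_trans (lerD (IH (ltnW mI)) (lexx _)) _ => {IH}.
(* z / (x + z) = 1 - x / (x + z) <= - ln (x / (x + z)). *)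
have ln_step (x z : nat) : (0 < x)%N ->
    ln (x%:R : R) + z%:R / (x + z)%:R <= ln ((x + z)%:R : R).
  move=> x0; have xR : 0 < x%:R :> R by rewrite ltr0n.
  have sR : 0 < (x + z)%:R :> R by rewrite ltr0n addn_gt0 x0.
  have : ln (1 + (x%:R / (x + z)%:R - 1)) <= x%:R / (x + z)%:R - 1 :> R.
    by apply: le_ln1Dx; rewrite ltrBrDr addrC subrr divr_gt0.
  rewrite addrC subrK ln_div ?posrE // -lerBlDl.
  have -> : z%:R / (x + z)%:R = 1 - x%:R / (x + z)%:R :> R.
    by move: sR; rewrite natrD => sR; field; rewrite gt_eqF.
  by move=> h; lra.
have cXZ := card_merge M.
rewrite (merge_next M) inE.
have [uX|uX] := boolP (u \in mergeX I m).
  rewrite (disjointFr (merge_XZ M) uX) addn0 mul1n cXZ (merge_X M uX).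
  by apply: ln_step; rewrite card_gt0 (merge_X0 M).
have [uZ|uZ] := boolP (u \in mergeZ I m).
  rewrite add0n mul1n cXZ (merge_Z M uZ) addnC.
  by apply: ln_step; rewrite card_gt0 (merge_Z0 M).
by rewrite mul0r addr0.
Qed.

Theorem theorem2 (R : realType) (V : finType) (n : nat) (cardV : #|V| = n)
    (I : clique_instance V) :
  expected_rand_cost R I <= 4 * ln (n%:R : R) * (opt I)%:R.
Proof.
rewrite -cardV; have [D [Dopt sepD]] := separation_opt I.
(* For an empty node set, [ln 0] is 0 by convention. *)
have lnn : 0 <= ln (#|V|%:R : R).
  by case: #|V| => [|k]; [rewrite ln0 | rewrite ln_ge0 // ler1n].
pose w (i : 'I_(steps I)) u : R :=
  ((u \in mergeX I i) * #|mergeZ I i| + (u \in mergeZ I i) * #|mergeX I i|)%:R /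
    (#|mergeX I i| + #|mergeZ I i|)%:R.
have growth u : \sum_(i < steps I) w i u <= ln (#|V|%:R : R).
  apply: le_trans (sum_growth_le_ln R u (leqnn _)) _.
  have c0 : (0 < #|clique (graph I (steps I)) u|)%N.
    by rewrite card_gt0; apply/set0Pn; exists u; apply: mem_clique.
  by rewrite ler_ln ?posrE ?ltr0n ?ler_nat ?(leq_trans c0) ?max_card.
have -> : expected_rand_cost R I =
    expect I (steps I) (fun c => (trajectory_cost (steps I) (rand_run I c))%:R) by [].
rewrite expect_trajectory_cost //.
apply: le_trans (_ : \sum_(i < steps I) \sum_u 2 * (conflicts D u)%:R * w i u <= _).
  apply: ler_sum => i _; have iI := ltn_ord i.
  apply: le_trans (_ : expect I i (fun c => 2 / (#|mergeX I i| + #|mergeZ I i|)%:R *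
      (separation (mergeX I i) (mergeZ I i) (rand_run I c i))%:R) <= _).
    apply: ler_expect => c; apply: average_step_cost => //.
    exact: rand_run_contiguous (ltnW iI).
  rewrite expectZ expect_separation // -mulrA.
  have := sepD _ iI; rewrite -(ler_nat R) => sep.
  have inv0 : 0 <= ((#|mergeX I i| + #|mergeZ I i|)%:R : R)^-1 by rewrite invr_ge0.
  apply: le_trans (ler_wpM2l _ (ler_wpM2l inv0 sep)) _ => //.
  rewrite natr_sum mulr_sumr mulr_sumr; apply: ler_sum => u _.
  by rewrite /w [in leLHS]natrM le_eqVlt; apply/orP; left; apply/eqP; ring.
(* Summing over the steps first lets the logarithmic bound apply to each node separately. *)
rewrite exchange_big /=.
apply: le_trans (_ : \sum_u 2 * (conflicts D u)%:R * ln (#|V|%:R : R) <= _).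
  apply: ler_sum => u _; rewrite -mulr_sumr; apply: ler_wpM2l; last exact: growth.
  by rewrite mulr_ge0 ?ler0n.
rewrite -mulr_suml -mulr_sumr -natr_sum.
have : (\sum_u conflicts D u)%:R <= 2 * (opt I)%:R :> R.
  rewrite -natrM ler_nat; apply: leq_trans (sum_conflicts D) _.
  by rewrite leq_mul2l.
(* One factor 2 comes from the two outcomes of a coin, the other from the two endpoints of a
   pair. *)
move=> h; rewrite (_ : 4 * _ * _ = 2 * (2 * (opt I)%:R) * ln #|V|%:R); last by ring.
by apply: ler_wpM2r => //; apply: ler_wpM2l.
Qed.
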